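(* Let $d\ge 2$ and let $\mathcal B=\mathcal B_q+\mathcal R_q$ be a linear constant-coefficient partial differential operator on $\mathbb R^d$ with non-homogeneous symbol, decomposed into its elementary (lowest-order) part $\mathcal B_q$, homogeneous of order $q\ge 0$, and its remainder $\mathcal R_q$, whose lowest-order nonzero homogeneous part has order $r>q$. Let $\mathcal S_q$ be a linear right inverse of $\mathcal B_q$ on polynomials such that $\mathcal S_q g\in\mathcal P_{n+q}$ for all $g\in\mathcal P_n$ and all $n\in\mathbb N_0$. (i) Let $N\in\mathbb N_0$. For any given non-zero $f\in\mathcal P_N$, the polynomial $u\in\mathcal P_{N+q}$ given by $$u=\mathcal S_q\sum_{j=0}^{m}\big(-\mathcal R_q\mathcal S_q\big)^j f,$$ with $m\in\mathbb N_0$ such that $(\mathcal R_q\mathcal S_q)^m f\neq 0$ and $(\mathcal R_q\mathcal S_q)^{m+1}f=0$, satisfies $\mathcal B u=f$ in $\mathbb R^d$. Thus $$\mathcal S:=\mathcal S_q\sum_{j\ge 0}\big(-\mathcal R_q\mathcal S_q\big)^j$$ defines a right inverse of $\mathcal B$ on polynomials, the sum being always finite when applied to a polynomial; in particular $m\le \lceil (N+1)/(r-q)\rceil-1$. (ii) In addition, for every $N\in\mathbb N_0$, $$\text{(a)}\quad \ker(\mathcal B|_{\mathcal P_N})=\big\{\,w-\mathcal S\mathcal R_q w \;:\; w\in\ker(\mathcal B_q|_{\mathcal P_N})\,\big\}\qquad\text{and}\qquad \text{(b)}\quad \dim\ker(\mathcal B|_{\mathcal P_N})=\dim\ker(\mathcal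 B_q|_{\mathcal P_N}).$$ (iii) In particular, if $q=0$ and the multiplication operator $\mathcal B_0$ is invertible, then $\ker(\mathcal B|_{\mathcal P_N})=\ker(\mathcal B_0|_{\mathcal P_N})=\{0\}$, so that the formula for $u$ in (i) defines the unique polynomial solution of $\mathcal B u=f$ in $\mathbb R^d$.
   Context: $\mathbb N_0=\{0,1,2,\dots\}$. $\mathcal P_N$ denotes the space of all $d$-variate polynomials (complex coefficients) of total degree at most $N$, and $\mathcal H_n\subset\mathcal P_n$ the $d$-variate homogeneous polynomials of total degree $n$. A constant-coefficient partial differential operator $\mathcal B=B(\partial)$ of order $p$ has total symbol $B(\xi)=\sum_{j=q}^{p}a_jB_j(\xi)$, $\xi\in\mathbb R^d$, with $p\ge q\ge 0$ integers, $p\geq 1$, $B_j\in\mathcal H_j$, $a_j\in\mathbb C$, $a_q\ne 0$, $a_p\neq 0$. The term of degree $q$ is the elementary part of the symbol. When $B$ is not homogeneous (so $p>q$), set $\mathcal B_q=a_qB_q(\partial)$, $\mathcal R_q=\sum_{j=q+1}^{p}a_jB_j(\partial)$, so that $\mathcal B=\mathcal B_q+\mathcal R_q$; $r$ denotes the first integer greater than $q$ for which $a_r\neq 0$. A right inverse $\mathcal S_q$ of $\mathcal B_q$ on polynomials is a map with $\mathcal B_q\mathcal S_q g=g$ for every polynomial $g$. For a linear constant-coefficient partial differential operator $\mathcal D$, $\mathcal D|_{\mathcal P_N}$ denotes its restriction to $\mathcal P_N$. *)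

(* Defs.v *)
From HB Require Import structures.
From mathcomp Require Import all_boot all_order all_algebra.
From mathcomp Require Import complex mpoly.
From mathcomp Require Import boolp classical_sets cardinality fsbigop reals.

Set Implicit Arguments.
Unset Strict Implicit.
Unset Printing Implicit Defensive.

Import GRing.Theory.

Local Open Scope ring_scope.

Section PolynomialsOfBoundedDegree.
Variables (n : nat) (R : nzRingType).

(* The space P_N.  As msize is one more than the total degree (and 0 for the
   zero polynomial), this is "total degree at most N". *)
Definition degle_pred (N : nat) : {pred {mpoly R[n]}} :=
  fun p => (msize p <= N.+1)%N.
Arguments degle_pred _ _ /.
Definition degle (N : nat) := [qualify p | degle_pred N p].

Lemma degleP N (p : {mpoly R[n]}) :
  reflect (forall m, m \in msupp p -> (mdeg m <= N)%N) (p \is degle N).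
Proof.
rewrite qualifE /= msizeE; apply: (iffP idP) => [h m mp|h].
  by rewrite -ltnS; apply: leq_trans h; rewrite -msizeE; exact: msize_mdeg_lt.
by rewrite big_seq; apply/bigmax_leqP_seq => m mp _; rewrite ltnS h.
Qed.

Lemma degle_submod_closed N : submod_closed (degle N).
Proof.
split=> [|c p q /degleP hp /degleP hq]; first by rewrite qualifE /= msize0.
apply/degleP => m /msuppD_le; rewrite mem_cat => /orP[/msuppZ_le|]; first exact: hp.
exact: hq.
Qed.

HB.instance Definition _ N :=
  GRing.isSubmodClosed.Build R {mpoly R[n]} (degle_pred N)
    (degle_submod_closed N).

(* P_N again, as a finite-dimensional vector space of its own. *)
Record mpolyle (N : nat) :=
  MPolyLe { mpoly_of_le :> {mpoly R[n]}; _ : mpoly_of_le \is degle N }.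

HB.instance Definition _ N := [isSub for @mpoly_of_le N].
HB.instance Definition _ N := [Choice of mpolyle N by <:].
HB.instance Definition _ N := [SubChoice_isSubLmodule of mpolyle N by <:].

Lemma mpolyle_vecaxiom N :
  Vector.axiom #|{: 'X_{1..n < N.+1}}| (mpolyle N).
Proof.
pose T : finType := 'X_{1..n < N.+1}.
pose f (p : mpolyle N) : 'rV[R]_#|T| :=
  \row_(i < #|T|) (val p)@_(bmnm (enum_val i)).
pose g (r : 'rV[R]_#|T|) : {mpoly R[n]} :=
  \sum_(i < #|T|) r 0 i *: 'X_[bmnm (enum_val i)].
have gP r : g r \is degle N.
  apply: rpred_sum => i _; apply: rpredZ.
  by apply/degleP => m /mem_msuppXP <-; rewrite -ltnS bmdeg.
exists f => [c p q|]; first by apply/rowP => i; rewrite !mxE /= mcoeffD mcoeffZ.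
exists (fun r => MPolyLe (gP r)) => [p|r]; last first.
  apply/rowP => i; rewrite mxE /= raddf_sum /= (bigD1 i) //= mcoeffZ mcoeffX.
  rewrite eqxx mulr1 big1 ?addr0 // => j ji.
  by rewrite mcoeffZ mcoeffX (inj_eq val_inj) (inj_eq enum_val_inj) (negbTE ji) mulr0.
apply/val_inj => /=; rewrite /g.
under eq_bigr do rewrite mxE.
have sp : (msize (val p) <= N.+1)%N by have := valP p; rewrite qualifE.
rewrite [RHS](mpolywE sp) [RHS](reindex (@enum_val _ (mem T))) /=.
  by apply: eq_bigl.
by apply: onW_bij; exact: enum_val_bij.
Qed.

HB.instance Definition _ N :=
  Lmodule_hasFinDim.Build R (mpolyle N) (mpolyle_vecaxiom N).

End PolynomialsOfBoundedDegree.
Arguments degle {n R} N.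

Section DifferentialOperators.
Variable n : nat.

(* P(partial) for P = \sum_m P_m xi^m: each variable xi_i is replaced by the
   i-th partial derivative, without any factor of the imaginary unit. *)
Definition diffop (R : comNzRingType) (P f : {mpoly R[n]}) : {mpoly R[n]} :=
  \sum_(m <- msupp P) P@_m *: f^`M[m].

Lemma diffop_is_linear (R : comNzRingType) (P : {mpoly R[n]}) :
  linear (diffop P).
Proof.
move=> c f g; rewrite /diffop scaler_sumr -big_split; apply: eq_bigr => m _.
by rewrite mderivmD mderivmZ scalerDr !scalerA mulrC.
Qed.

HB.instance Definition _ (R : comNzRingType) (P : {mpoly R[n]}) :=
  GRing.isLinear.Build R {mpoly R[n]} {mpoly R[n]} _ (diffop P)
    (diffop_is_linear P).

Lemma diffop_degle (R : comNzRingType) N (P f : {mpoly R[n]}) :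
  f \is degle N -> diffop P f \is degle N.
Proof.
move=> /degleP hf; apply: rpred_sum => m _; apply: rpredZ.
apply/degleP => m'; rewrite mcoeff_msupp mcoeff_mderivm => h.
apply: (@leq_trans (mdeg (m + m')%MM)); first by rewrite mdegD leq_addl.
by apply: hf; rewrite mcoeff_msupp; apply: contraNneq h => ->; rewrite mul0rn.
Qed.

Variables (F : fieldType) (N : nat).

Definition diffop_restr (P : {mpoly F[n]}) (f : mpolyle n F N) :
    mpolyle n F N :=
  MPolyLe (diffop_degle P (valP f)).

Lemma diffop_restr_is_linear (P : {mpoly F[n]}) : linear (diffop_restr P).
Proof. by move=> c f g; apply/val_inj; rewrite /= linearP. Qed.

HB.instance Definition _ (P : {mpoly F[n]}) :=
  GRing.isLinear.Build F (mpolyle n F N) (mpolyle n F N) _ (diffop_restr P)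
    (diffop_restr_is_linear P).

Definition diffop_ker (P : {mpoly F[n]}) : {vspace mpolyle n F N} :=
  lker (linfun (diffop_restr P)).

End DifferentialOperators.

Section Symbols.
Variables (n : nat) (F : fieldType).
Variables (q p : nat) (a : nat -> F) (B : nat -> {mpoly F[n]}).

(* The values of a and B at indices outside {q, ..., p} are irrelevant. *)
Definition symbol_data : Prop :=
  [/\ (q <= p)%N, (1 <= p)%N,
      forall j, (q <= j <= p)%N -> B j \is j.-homog,
      a q != 0 & a p != 0].

Definition total_symbol : {mpoly F[n]} := \sum_(q <= j < p.+1) a j *: B j.
Definition elementary_part : {mpoly F[n]} := a q *: B q.
Definition remainder_part : {mpoly F[n]} := \sum_(q.+1 <= j < p.+1) a j *: B j.

(* The homogeneous terms a_j B_j are tested rather than the coefficients a_j,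
   so that r is the genuine lowest order even if some B_j happens to vanish.
   Such an r exists only if the remainder is non-zero. *)
Definition remainder_order (r : nat) : Prop :=
  [/\ (q < r <= p)%N, a r *: B r != 0 &
      forall j, (q < j < r)%N -> a j *: B j = 0].

End Symbols.

Section NeumannSeries.
Variables (n : nat) (F : fieldType).
Variables (Rq Sq : {mpoly F[n]} -> {mpoly F[n]}).

Definition neumann_term (j : nat) (f : {mpoly F[n]}) : {mpoly F[n]} :=
  iter j (fun g => - Rq (Sq g)) f.

(* The sum over [set: nat] is that of the non-zero terms when there are
   finitely many of them, and 0 otherwise. *)
Definition neumann_inverse (f : {mpoly F[n]}) : {mpoly F[n]} :=
  Sq (\sum_(j \in [set: nat]%classic) neumann_term j f).

End NeumannSeries.

(* Main.v *)
Require Import Defs.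
From HB Require Import structures.
From mathcomp Require Import all_boot all_order all_algebra.
From mathcomp Require Import complex ssrcomplements mpoly.
From mathcomp Require Import boolp classical_sets cardinality fsbigop reals.

(** The formula for a right inverse comes from factoring [B] through its
    elementary part.  Since [Bq Sq = 1], for every polynomial [v]

      [B v = Bq v + Rq v = Bq (v + Sq (Rq v)) = Bq (T v)], [T = 1 + Sq Rq].

    Applying [Rq] lowers the degree by at least [r] ([msize_diffop]), applying
    [Sq] raises it by at most [q], and [q < r].  So [Sq Rq] and [Rq Sq] both
    lower degrees by at least [r - q]: [T] is unipotent on each space of
    polynomials of bounded degree, and the Neumann series of [1 + Rq Sq]
    terminates.  Telescoping that series gives [T (S g) = Sq g]
    ([rfactor_neumann]), from which everything follows:

    - [B (S g) = Bq (T (S g)) = Bq (Sq g) = g], so [S] is a right inverse of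
      [B]; the bound on the number of terms is the degree count;

    - [T (w - S (Rq w)) = w + Sq (Rq w) - Sq (Rq w) = w], so [1 - S Rq] is the
      inverse of [T]; both maps preserve the bound on the degree, and
      [ker B], which is the preimage of [ker Bq] under [T], is the image of
      [ker Bq] under [1 - S Rq], of the same dimension;

    - if [Bq] is injective, so is [B = Bq T], whence uniqueness. *)

Set Implicit Arguments.
Unset Strict Implicit.
Unset Printing Implicit Defensive.

Import Order.TTheory GRing.Theory Num.Theory.

Local Open Scope ring_scope.

(** * Constant-coefficient operators and degrees *)

Lemma degleE (n : nat) (R : nzRingType) (N : nat) (p : {mpoly R[n]}) :
  (p \is degle N) = (msize p <= N.+1)%N.
Proof. by []. Qed.

Section ConstantCoefficientOperators.
Variables (n : nat) (R : comNzRingType).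
Implicit Types P Q f : {mpoly R[n]}.

(** A range of summation that does not depend on [P] is what makes additivity in
    the symbol a termwise matter. *)
Lemma diffop_widen k P f : (msize P <= k)%N ->
  diffop P f = \sum_(m : 'X_{1..n < k}) P@_m *: f^`M[m].
Proof.
move=> Pk; rewrite /diffop (big_mksub 'X_{1..n < k}) //=; first last.
- by move=> m /msize_mdeg_lt mP; apply: leq_trans mP Pk.
- exact: msupp_uniq.
by rewrite big_rmcond // => m /memN_msupp_eq0 ->; rewrite scale0r.
Qed.

Lemma diffopDl P Q f : diffop (P + Q) f = diffop P f + diffop Q f.
Proof.
set k := maxn (msize (P + Q)) (maxn (msize P) (msize Q)).
rewrite !(@diffop_widen k) ?leq_max ?leqnn ?orbT //.
by rewrite -big_split; apply: eq_bigr => m _; rewrite mcoeffD scalerDl.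
Qed.

(** As [msize] is the degree plus one, and zero for the zero polynomial, the
    truncated subtraction also records that a polynomial of degree below [r] is
    killed. *)
Lemma msize_diffop (r : nat) P f :
    (forall m, m \in msupp P -> (r <= mdeg m)%N) ->
  (msize (diffop P f) <= msize f - r)%N.
Proof.
move=> Pr; rewrite msizeE big_seq; apply/bigmax_leqP_seq => m mPf _.
(* [m] occurs in some derivative of [f] of order at least [r]. *)
suff mf : (mdeg m + r < msize f)%N by rewrite ltn_subRL addnC.
move: mPf; rewrite mcoeff_msupp /diffop raddf_sum /=; apply: contraNT.
rewrite -leqNgt => fm; rewrite big_seq big1 // => m' /Pr rm'.
rewrite mcoeffZ mcoeff_mderivm (@memN_msupp_eq0 _ _ f) ?mul0rn ?mulr0 //.
apply/negP => /msize_mdeg_lt; rewrite mdegD ltnNge => /negP[].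
by rewrite (leq_trans fm) // addnC leq_add2r.
Qed.

End ConstantCoefficientOperators.

Lemma diffop_kerP (n : nat) (F : fieldType) (N : nat) (P : {mpoly F[n]})
    (f : mpolyle n F N) :
  reflect (diffop P (val f) = 0) (f \in diffop_ker N P).
Proof.
rewrite memv_ker lfunE /=; apply: (iffP eqP) => [/(congr1 val) //|Pf].
exact/val_inj.
Qed.

Lemma diffop_ker_eq0 (n : nat) (F : fieldType) (N : nat) (P : {mpoly F[n]}) :
  injective (diffop P) -> diffop_ker N P = 0%VS.
Proof.
move=> P_inj; apply/eqP; rewrite -subv0; apply/subvP => f /diffop_kerP Pf.
by rewrite memv0; apply/eqP/val_inj/P_inj; rewrite Pf linear0.
Qed.

Lemma mdeg_remainder_part (n : nat) (F : fieldType) (q p r : nat)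
    (a : nat -> F) (B : nat -> {mpoly F[n]}) :
    symbol_data q p a B -> remainder_order q p a B r ->
  forall m, m \in msupp (remainder_part q p a B) -> (r <= mdeg m)%N.
Proof.
move=> [_ _ Bhom _ _] [/andP[qr rp] _ B0] m.
rewrite mcoeff_msupp raddf_sum /=; apply: contraNT; rewrite -ltnNge => mr.
rewrite big_nat big1 // => j /andP[qj jp].
have [jr|rj] := ltnP j r; first by rewrite B0 ?qj // mcoeff0.
rewrite mcoeffZ (dhomog_nemf_coeff (Bhom j _)) ?mulr0 ?(ltnW qj) //.
by rewrite neq_ltn (leq_trans mr).
Qed.

Lemma total_symbolE (n : nat) (F : fieldType) (q p : nat)
    (a : nat -> F) (B : nat -> {mpoly F[n]}) : (q <= p)%N ->
  total_symbol q p a B = elementary_part q a B + remainder_part q p a B.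
Proof. by move=> qp; rewrite /total_symbol big_ltn. Qed.

(** * The Neumann series and the right factor *)

(** The bound on [Sq] is in terms of [msize] so that it covers the zero
    polynomial. *)
Section NeumannSeries.
Variables (n : nat) (F : fieldType).
Variables (Rq Sq : {linear {mpoly F[n]} -> {mpoly F[n]}}).
Variables (q r : nat).
Hypothesis q_lt_r : (q < r)%N.
Hypothesis msizeRq : forall f, (msize (Rq f) <= msize f - r)%N.
Hypothesis msizeSq : forall f, (msize (Sq f) <= msize f + q)%N.
Implicit Types f g v w : {mpoly F[n]}.

Local Notation A := (Rq \o Sq).
Local Notation term := (neumann_term Rq Sq).
Local Notation S := (neumann_inverse Rq Sq).

Lemma msize_iter j f : (msize (iter j A f) <= msize f - j * (r - q))%N.
Proof.
elim: j => [|j IHj]; first by rewrite subn0.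
rewrite iterS /=; apply: leq_trans (msizeRq _) _.
rewrite mulSn addnC subnDA (subnBA _ (ltnW q_lt_r)).
by apply: leq_sub2r; apply: leq_trans (msizeSq _) _; rewrite leq_add2r.
Qed.

Lemma iter_eq0 j f : (msize f <= j * (r - q))%N -> iter j A f = 0.
Proof.
move=> fj; apply/eqP; rewrite -msize_poly_eq0 -leqn0.
by apply: leq_trans (msize_iter j f) _; rewrite leqn0 subn_eq0.
Qed.

Lemma iter_size f : iter (msize f) A f = 0.
Proof. by apply: iter_eq0; rewrite leq_pmulr // subn_gt0. Qed.

Lemma neumann_termE j f : term j f = (-1) ^+ j *: iter j A f.
Proof.
elim: j => [|j IHj]; first by rewrite scale1r.
rewrite /neumann_term !iterS -/(term j f) IHj /= !linearZ /=.
by rewrite exprS mulN1r scaleNr scalerN.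
Qed.

Lemma neumann_term_eq0 K j f : iter K A f = 0 -> (K <= j)%N -> term j f = 0.
Proof.
move=> fK Kj; rewrite neumann_termE -(subnK Kj) iterD fK.
rewrite [X in _ *: X](_ : _ = 0) ?scaler0 //.
by elim: (j - K)%N => //= i ->; rewrite !linear0.
Qed.

Lemma finite_neumann f : finite_set [set j | term j f != 0]%classic.
Proof.
apply: (@sub_finite_set _ _ `I_(msize f)); last exact: finite_II.
move=> j /=; apply: contraNT; rewrite -leqNgt => fj; apply/eqP.
exact: neumann_term_eq0 (iter_size f) fj.
Qed.

Lemma neumann_inverseE K f : iter K A f = 0 ->
  S f = Sq (\sum_(0 <= j < K) term j f).
Proof.
move=> fK; congr (Sq _); rewrite big_mkord fsbig_ord; apply/esym.
apply: fsbig_widen => // j [_ /negP]; rewrite -leqNgt /= => Kj.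
exact: neumann_term_eq0 fK Kj.
Qed.

(** The geometric sum: [(1 + Rq Sq) (1 + A' + ... + A'^(K-1)) = 1 - A'^K] for
    [A' = - Rq Sq], and the last term vanishes. *)
Lemma sum_neumann_term K f : iter K A f = 0 ->
  let h := \sum_(0 <= j < K) term j f in h + Rq (Sq h) = f.
Proof.
move=> fK /=; rewrite !linear_sum -big_split /=.
rewrite (telescope_sumr_eq (fun j => - term j f)) => [||j _] //.
- by rewrite opprK (neumann_term_eq0 fK) // oppr0 add0r.
- by rewrite opprK /= addrC opprK.
Qed.

Lemma msize_neumann_sum K f :
  (msize (\sum_(0 <= j < K) term j f) <= msize f)%N.
Proof.
have [->|f0] := eqVneq f 0.
  by rewrite big1 // => j _; apply: (neumann_term_eq0 (K := 0)).
suff : \sum_(0 <= j < K) term j f \is degle (msize f).-1.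
  by rewrite degleE prednK // lt0n msize_poly_eq0.
apply: rpred_sum => j _; rewrite neumann_termE; apply: rpredZ.
rewrite degleE; apply: leq_trans (msize_iter j f) _.
by rewrite (leq_trans (leq_subr _ _)) // leqSpred.
Qed.

(** The right factor of [B = Bq T]. *)
Local Notation T := (idfun \+ (Sq \o Rq)).

(** Composing the two degree bounds naively loses the drop when [g = 0], where
    [msize f - r] is truncated; that case needs [Sq 0 = 0] instead. *)
Lemma msize_Sq_drop f g : (msize g <= msize f - r)%N ->
  (msize (Sq g) <= msize f - (r - q))%N.
Proof.
have [->|g0] := eqVneq g 0; first by rewrite linear0 msize0.
move=> gf; have rf : (r < msize f)%N.
  by rewrite -subn_gt0; apply: leq_trans gf; rewrite lt0n msize_poly_eq0.
rewrite (subnBA _ (ltnW q_lt_r)) -addnBAC ?(ltnW rf) //.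
by apply: leq_trans (msizeSq g) _; rewrite leq_add2r.
Qed.

(** A [v] with [T v = 0] equals [- Sq (Rq v)], which has a smaller degree unless
    it is zero. *)
Lemma rfactor_inj : injective T.
Proof.
apply: raddf_inj => v /= /eqP; rewrite addrC addr_eq0 => /eqP SRv.
apply/eqP; rewrite -msize_poly_eq0 -leqn0 leqNgt; apply/negP => v_gt0.
have := msize_Sq_drop (msizeRq v); rewrite SRv msizeN leqNgt => /negP[].
by rewrite ltn_subrL subn_gt0 q_lt_r.
Qed.

(** The push-through identity [(1 + Sq Rq) Sq = Sq (1 + Rq Sq)] moves [T] past
    [Sq], where it meets the series inverting [1 + Rq Sq]. *)
Lemma rfactor_neumann g : T (S g) = Sq g.
Proof.
rewrite (neumann_inverseE (iter_size g)) /= -linearD /=.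
by rewrite (sum_neumann_term (iter_size g)).
Qed.

Lemma rfactorK : cancel T (fun w => w - S (Rq w)).
Proof.
move=> v; apply: rfactor_inj.
by rewrite raddfB /= [X in _ - X]rfactor_neumann /= addrK.
Qed.

Lemma rfactorVK : cancel (fun w => w - S (Rq w)) T.
Proof.
by move=> w; rewrite raddfB /= [X in _ - X]rfactor_neumann /= addrK.
Qed.

Lemma rfactor_degle N v : v \is degle N -> T v \is degle N.
Proof.
move=> vN /=; apply: rpredD => //; move: vN; rewrite !degleE /=.
by apply: leq_trans; apply: leq_trans (msize_Sq_drop (msizeRq v)) (leq_subr _ _).
Qed.

Lemma rfactorV_degle N w : w \is degle N -> w - S (Rq w) \is degle N.
Proof.
move=> wN; apply: rpredB => //; move: wN; rewrite !degleE /=.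
apply: leq_trans; rewrite (neumann_inverseE (iter_size _)).
apply: leq_trans (leq_subr (r - q) _); apply: msize_Sq_drop.
exact: leq_trans (msize_neumann_sum _ _) (msizeRq w).
Qed.

Lemma neumann_inverse_degle N f : f \is degle N -> S f \is degle (N + q).
Proof.
rewrite !degleE (neumann_inverseE (iter_size f)) => fN.
apply: leq_trans (msizeSq _) _; rewrite -addSn leq_add2r.
exact: leq_trans (msize_neumann_sum _ _) fN.
Qed.

Lemma last_iter_exists f : f != 0 ->
  exists m, iter m A f != 0 /\ iter m.+1 A f = 0.
Proof.
move=> f0; have fA : exists m, iter m A f == 0.
  by exists (msize f); rewrite iter_size.
case: (ex_minnP fA) => -[|m] /eqP fm m_min; first by rewrite -fm eqxx in f0.
by exists m; split=> //; apply/negP => /m_min; rewrite ltnn.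
Qed.

Lemma last_iter_le N m f : f \is degle N -> iter m A f != 0 ->
  m%:Z <= Num.ceil (N.+1%:R / (r - q)%N%:R : rat) - 1.
Proof.
rewrite degleE => fN fm.
have mN : (m * (r - q) < N.+1)%N.
  rewrite ltnNge; apply: contraNN fm => Nm.
  by rewrite iter_eq0 // (leq_trans fN).
(* Over the integers, [m <= c - 1] is [m < c], which compares with a ceiling
   without rounding. *)
rewrite lerBrDr lezD1 ceil_gt_int -pmulrn ltr_pdivlMr ?ltr0n ?subn_gt0 //.
by rewrite -natrM ltr_nat.
Qed.

(** * Kernels *)

Definition rfactor_restr N (v : mpolyle n F N) : mpolyle n F N :=
  MPolyLe (rfactor_degle (valP v)).

Lemma rfactor_restr_is_linear N : linear (@rfactor_restr N).
Proof.
by move=> c v w; apply/val_inj; rewrite /= !linearP /= scalerDr addrACA.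
Qed.

HB.instance Definition _ N :=
  GRing.isLinear.Build F (mpolyle n F N) (mpolyle n F N) _
    (@rfactor_restr N) (@rfactor_restr_is_linear N).

(** [P] and [Pq] are the symbols of [B] and [Bq]. *)
Variables P Pq : {mpoly F[n]}.
Hypothesis diffopP : forall v, diffop P v = diffop Pq v + Rq v.
Hypothesis SqK : cancel Sq (diffop Pq).

Lemma diffop_rfactor v : diffop P v = diffop Pq (T v).
Proof. by rewrite diffopP linearD /= SqK. Qed.

Lemma neumann_inverseK : cancel S (diffop P).
Proof. by move=> f; rewrite diffop_rfactor rfactor_neumann SqK. Qed.

Lemma diffop_inj : injective (diffop Pq) -> injective (diffop P).
Proof.
by move=> Pq_inj v w; rewrite !diffop_rfactor => /Pq_inj; apply: rfactor_inj.
Qed.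

Lemma rfactorV_ker N (w : mpolyle n F N) : w \in diffop_ker N Pq ->
  MPolyLe (rfactorV_degle (valP w)) \in diffop_ker N P.
Proof.
move=> /diffop_kerP Pw; apply/diffop_kerP; rewrite diffop_rfactor -[RHS]Pw.
by congr diffop; apply: rfactorVK.
Qed.

Lemma mem_diffop_ker N (v : {mpoly F[n]}) :
  (exists2 v' : mpolyle n F N, v' \in diffop_ker N P & v = val v') <->
  (exists2 w : mpolyle n F N,
     w \in diffop_ker N Pq & v = val w - S (Rq (val w))).
Proof.
split=> [[v' /diffop_kerP Pv' ->]|[w wPq ->]].
  exists (rfactor_restr v'); last exact/esym/rfactorK.
  by apply/diffop_kerP; rewrite -diffop_rfactor.
by exists (MPolyLe (rfactorV_degle (valP w))); first exact: rfactorV_ker.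
Qed.

(** [T] embeds the kernel of [B] into that of [Bq], and [1 - S Rq] shows that it
    is onto. *)
Lemma dim_diffop_ker N : \dim (diffop_ker N P) = \dim (diffop_ker N Pq).
Proof.
pose f := linfun (@rfactor_restr N).
have f0 : lker f == 0%VS.
  apply/lker0P => v w; rewrite !lfunE /= => /(congr1 val) /=.
  by move/rfactor_inj/val_inj.
rewrite -(limg_dim_eq (f := f)); last by rewrite (eqP f0) capv0.
congr (\dim _); apply/vspaceP => w; apply/memv_imgP/diffop_kerP.
  move=> [v /diffop_kerP Pv ->].
  by rewrite lfunE /= -[LHS]diffop_rfactor.
move/diffop_kerP=> wPq; exists (MPolyLe (rfactorV_degle (valP w))).
  exact: rfactorV_ker.
by rewrite lfunE; apply/val_inj/esym/rfactorVK.
Qed.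

End NeumannSeries.

(** * The theorem *)

Theorem theorem2 (R : realType) (d : nat) (d_ge2 : (2 <= d)%N)
    (q p r : nat) (a : nat -> R[i]) (B : nat -> {mpoly R[i][d]})
    (symbolB : symbol_data q p a B)
    (orderR : remainder_order q p a B r)
    (Sq : {linear {mpoly R[i][d]} -> {mpoly R[i][d]}})
    (Sq_rinv : forall g : {mpoly R[i][d]},
       diffop (elementary_part q a B) (Sq g) = g)
    (Sq_deg : forall (n : nat) (g : {mpoly R[i][d]}),
       g \is degle n -> Sq g \is degle (n + q)%N) :
  let Bsym := total_symbol q p a B in
  let Bqsym := elementary_part q a B in
  let Bop := diffop Bsym in
  let Rq := diffop (remainder_part q p a B) in
  let Sinv := neumann_inverse Rq Sq in
  let last_index (f : {mpoly R[i][d]}) (m : nat) :=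
    iter m (Rq \o Sq) f != 0 /\ iter m.+1 (Rq \o Sq) f = 0 in
  let solution (f : {mpoly R[i][d]}) (m : nat) :=
    Sq (\sum_(0 <= j < m.+1) neumann_term Rq Sq j f) in
  (* (i) *)
  [/\ forall (N : nat) (f : {mpoly R[i][d]}), f \is degle N -> f != 0 ->
        (exists m : nat, last_index f m) /\
        (forall m : nat, last_index f m ->
           [/\ solution f m \is degle (N + q)%N,
               Bop (solution f m) = f &
               m%:Z <= Num.ceil (N.+1%:R / (r - q)%N%:R : rat) - 1]),
      forall f : {mpoly R[i][d]},
        finite_set [set j : nat | neumann_term Rq Sq j f != 0]%classic /\
        Bop (Sinv f) = f,
  (* (ii) *)
      forall N : nat,
        (forall v : {mpoly R[i][d]},
           (exists2 v' : mpolyle d R[i] N,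
              v' \in diffop_ker N Bsym & v = val v') <->
           (exists2 w : mpolyle d R[i] N,
              w \in diffop_ker N Bqsym & v = val w - Sinv (Rq (val w)))) /\
        \dim (diffop_ker N Bsym) = \dim (diffop_ker N Bqsym) &
  (* (iii) *)
      q = 0%N -> bijective (diffop Bqsym) ->
        (forall N : nat,
           diffop_ker N Bsym = diffop_ker N Bqsym /\
           diffop_ker N Bqsym = 0%VS) /\
        (forall (N : nat) (f : {mpoly R[i][d]}), f \is degle N -> f != 0 ->
           forall m : nat, last_index f m ->
             forall v : {mpoly R[i][d]}, Bop v = f <-> v = solution f m)].
Proof.
have [qp _ _ _ _] := symbolB; have [/andP[qr _] _ _] := orderR.
have msizeRq (f : {mpoly R[i][d]}) :
    (msize (diffop (remainder_part q p a B) f) <= msize f - r)%N.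
  exact/msize_diffop/(mdeg_remainder_part symbolB orderR).
have msizeSq (f : {mpoly R[i][d]}) : (msize (Sq f) <= msize f + q)%N.
  have [->|f0] := eqVneq f 0; first by rewrite linear0 msize0.
  have /prednK <- : (0 < msize f)%N by rewrite lt0n msize_poly_eq0.
  by rewrite addSn -degleE Sq_deg // degleE leqSpred.
have diffopB (v : {mpoly R[i][d]}) : diffop (total_symbol q p a B) v =
    diffop (elementary_part q a B) v + diffop (remainder_part q p a B) v.
  by rewrite total_symbolE // diffopDl.
move=> Bsym Bqsym Bop Rq Sinv last_index solution.
have solutionE f m : last_index f m -> solution f m = Sinv f.
  by move=> [_ fm]; rewrite /Sinv (neumann_inverseE fm).
have SinvK f : Bop (Sinv f) = f.
  exact: (neumann_inverseK qr msizeRq msizeSq diffopB Sq_rinv).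
split=> [N f fN f0|f|N|q0 /bij_inj Bq_inj].
- split=> [|m fm]; first exact: (last_iter_exists qr msizeRq msizeSq).
  rewrite solutionE //; split.
  - exact: (neumann_inverse_degle qr msizeRq msizeSq).
  - exact: SinvK.
  - exact: (last_iter_le qr msizeRq msizeSq fN fm.1).
- by split; first exact: (finite_neumann qr msizeRq msizeSq).
- split=> [v|]; first exact: (mem_diffop_ker qr msizeRq msizeSq diffopB Sq_rinv).
  exact: (dim_diffop_ker qr msizeRq msizeSq diffopB Sq_rinv).
- have B_inj : injective Bop.
    exact: (diffop_inj qr msizeRq msizeSq diffopB Sq_rinv).
  split=> [N|N f _ _ m fm v].
    by rewrite !diffop_ker_eq0.
  rewrite (solutionE _ _ fm); split=> [Bv|->]; last exact: SinvK.
  by apply: B_inj; rewrite SinvK.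
Qed.
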